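(* Let $q=19^3$ and let $\mathbf{F}_q=\mathbf{F}_{19}[c]$ with $c^3=8c^2+4c+11$. The polynomial $$P(T)=T^5+(11+17c+9c^2)T^4+(3+7c+18c^2)T^3+(2+5c+6c^2)T^2+(3+3c+11c^2)T+(6+17c+5c^2)$$ in $\mathbf{F}_q[T]$ is irreducible over $\mathbf{F}_q$ and is a $c$-Wieferich prime of degree $5$, i.e. $\rho_P(1)\equiv 1\pmod{P^2}$. Consequently $\gcd([5],M_5)\neq 1$ in $\mathbf{F}_{19^3}[T]$, although $19\nmid 5$. Moreover, $P$ is not fixed by any nontrivial additive translation: for every $\gamma\in\mathbf{F}_q^\times$ one has $P(T+\gamma)\neq P(T)$.
   Context: Let $q$ be a power of an odd prime $p$ and $A=\mathbf{F}_q[T]$. For $n\ge 1$ put $[n]=T^{q^n}-T\in A$. The Carlitz module is the $\mathbf{F}_q$-algebra homomorphism $\rho\colon A\to A\{\tau\}$ into the twisted polynomial ring (with $\tau x=x^q\tau$ for $x\in A$) determined by $\rho_T=T+\tau$. For $a\in A$, $\rho_a(x)$ denotes the associated $\mathbf{F}_q$-linear polynomial: if $\rho_a=\sum_i a_i\tau^i$ then $\rho_a(x)=\sum_i a_i x^{q^i}$; so $\rho_a(1)=\sum_i a_i$. A ''prime'' of $A$ is an irreducible polynomial. A monic prime $P\in A$ is called a $c$-Wieferich prime (to base $1$) if $\rho_P(1)\equiv 1\pmod{P^2}$. (The letter $c$ in ''$c$-Wieferich'' is part of the name and is unrelated to the element $c$ of $\mathbf{F}_{19^3}$.) For $d\ge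 1$ define $$M_d=\sum_{k=0}^{d-1}(-1)^k[d-1][d-2]\cdots[d-k]\in A,$$ the $k=0$ term being $1$. *)

(* Defs.v *)
From HB Require Import structures.
From mathcomp Require Import all_boot all_order all_algebra all_field.

Set Implicit Arguments.
Unset Strict Implicit.
Unset Printing Implicit Defensive.

Import GRing.Theory.

Local Open Scope ring_scope.

(* A{tau} for A = F[T] and q = #|F|: the polynomial \sum_i a_i 'X^i over       *)
(* A = {poly F} stands for \sum_i a_i tau^i, and tau a = a^q tau.             *)
Definition twisted_poly (F : finFieldType) : Type := {poly {poly F}}.

Definition twisted_mul (F : finFieldType) (f g : twisted_poly F) :
    twisted_poly F :=
  \sum_(i < size (f : {poly {poly F}})) \sum_(j < size (g : {poly {poly F}}))
     ((f : {poly {poly F}})`_i * (g : {poly {poly F}})`_j ^+ (#|F| ^ i)%N)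
       *: 'X^(i + j).

Section TwistedPolyRing.

Variable F : finFieldType.
Implicit Types (a b : {poly F}) (f g h : {poly {poly F}}).

Let q := #|F|.

Lemma twisted_exprD i a b :
  (a + b) ^+ (q ^ i)%N = a ^+ (q ^ i)%N + b ^+ (q ^ i)%N.
Proof.
have [p p_pr pchF] := finPcharP F.
have pchA : p \in [pchar {poly F}] by rewrite pchar_poly.
rewrite exprDn_pchar // (eq_pnat _ (pcharf_eq pchA)) pnatX.
by rewrite /q (card_pprimeChar pchF) pnatX pnat_id.
Qed.

Lemma twisted_mulE f g m n : (size f <= m)%N -> (size g <= n)%N ->
  twisted_mul f g =
  \sum_(i < m) \sum_(j < n) (f`_i * g`_j ^+ (q ^ i)%N) *: 'X^(i + j).
Proof.
move=> fm gn.
have q0 i : (q ^ i == 0)%N = false.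
  by apply/negbTE; rewrite -lt0n expn_gt0 /q (cardD1 0).
rewrite /twisted_mul (big_ord_widen m (fun i =>
  \sum_(j < size g) (f`_i * g`_j ^+ (q ^ i)%N) *: 'X^(i + j))) //.
rewrite big_mkcond; apply: eq_bigr => i _.
case: ltnP => [_|fi]; last first.
  by rewrite big1 // => j _; rewrite nth_default // mul0r scale0r.
rewrite (big_ord_widen n (fun j =>
  (f`_i * g`_j ^+ (q ^ i)%N) *: 'X^(i + j))) // big_mkcond.
apply: eq_bigr => j _; case: ltnP => // gj.
by rewrite [g`_j]nth_default // expr0n q0 mulr0 scale0r.
Qed.

Lemma twisted_mulDl f g h :
  twisted_mul (f + g) h = twisted_mul f h + twisted_mul g h :> {poly {poly F}}.
Proof.
pose m := maxn (size f) (size g).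
rewrite !(@twisted_mulE _ h m (size h)) ?leq_maxl ?leq_maxr ?size_polyD //.
rewrite -big_split; apply: eq_bigr => i _; rewrite -big_split.
by apply: eq_bigr => j _; rewrite coefD mulrDl scalerDl.
Qed.

Lemma twisted_mulDr f g h :
  twisted_mul f (g + h) = twisted_mul f g + twisted_mul f h :> {poly {poly F}}.
Proof.
pose m := maxn (size g) (size h).
rewrite !(@twisted_mulE f _ (size f) m) ?leq_maxl ?leq_maxr ?size_polyD //.
rewrite -big_split; apply: eq_bigr => i _; rewrite -big_split.
by apply: eq_bigr => j _; rewrite coefD twisted_exprD mulrDr scalerDl.
Qed.

Lemma twisted_mul_monom a b i j :
  twisted_mul (a *: 'X^i) (b *: 'X^j) =
  (a * b ^+ (q ^ i)%N) *: 'X^(i + j) :> {poly {poly F}}.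
Proof.
have q0 k : (q ^ k == 0)%N = false.
  by apply/negbTE; rewrite -lt0n expn_gt0 /q (cardD1 0).
have sz (c : {poly F}) k : (size (c *: 'X^k) <= k.+1)%N.
  by rewrite (leq_trans (size_scale_leq _ _)) ?size_polyXn.
rewrite (twisted_mulE (sz a i) (sz b j)) (bigD1 ord_max) //=.
rewrite [X in _ + X]big1 => [|k /negbTE ki]; last first.
  apply: big1 => l _; rewrite coefZ coefXn.
  by rewrite (_ : (k == i :> nat) = false) ?mulr0 ?mul0r ?scale0r.
rewrite addr0 (bigD1 ord_max) //= big1 => [|k /negbTE kj]; last first.
  rewrite !coefZ !coefXn (_ : (k == j :> nat) = false) //.
  by rewrite mulr0 expr0n q0 mulr0 scale0r.
by rewrite addr0 !coefZ !coefXn !eqxx !mulr1.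
Qed.

Lemma twisted_ind (Q : {poly {poly F}} -> Prop) :
  Q 0 -> (forall f g, Q f -> Q g -> Q (f + g)) ->
  (forall a i, Q (a *: 'X^i)) -> forall f, Q f.
Proof.
move=> Q0 QD Qm f; rewrite -[f]coefK poly_def.
by apply: big_ind => // i _.
Qed.

Lemma twisted_mul0l g : twisted_mul 0 g = 0 :> {poly {poly F}}.
Proof. by apply: (@addrI _ (twisted_mul 0 g)); rewrite -twisted_mulDl !addr0. Qed.

Lemma twisted_mul0r f : twisted_mul f 0 = 0 :> {poly {poly F}}.
Proof. by apply: (@addrI _ (twisted_mul f 0)); rewrite -twisted_mulDr !addr0. Qed.

Lemma twisted_mulA f g h :
  twisted_mul f (twisted_mul g h) = twisted_mul (twisted_mul f g) h.
Proof.
elim/twisted_ind: f => [|f f' IH IH'|a i].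
- by rewrite !twisted_mul0l.
- by rewrite !twisted_mulDl IH IH'.
elim/twisted_ind: g => [|g g' IH IH'|b j].
- by rewrite twisted_mul0l !twisted_mul0r twisted_mul0l.
- by rewrite !(twisted_mulDl, twisted_mulDr) IH IH'.
elim/twisted_ind: h => [|h h' IH IH'|c k].
- by rewrite !twisted_mul0r.
- by rewrite !twisted_mulDr IH IH'.
by rewrite !twisted_mul_monom exprMn -exprM -expnD mulrA addnA [(j + i)%N]addnC.
Qed.

Lemma twisted_mul1l g : twisted_mul 1 g = g.
Proof.
elim/twisted_ind: g => [|g g' IH IH'|b j]; first exact: twisted_mul0r.
  by rewrite twisted_mulDr IH IH'.
have -> : 1 = (1 : {poly F}) *: 'X^0 by rewrite scale1r expr0.
by rewrite twisted_mul_monom expn0 expr1 mul1r.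
Qed.

Lemma twisted_mul1r f : twisted_mul f 1 = f.
Proof.
elim/twisted_ind: f => [|g g' IH IH'|b j]; first exact: twisted_mul0l.
  by rewrite twisted_mulDl IH IH'.
have -> : 1 = (1 : {poly F}) *: 'X^0 by rewrite scale1r expr0.
by rewrite twisted_mul_monom expr1n mulr1 addn0.
Qed.

HB.instance Definition _ := GRing.Zmodule.copy (twisted_poly F) {poly {poly F}}.

HB.instance Definition _ := GRing.Zmodule_isNzRing.Build (twisted_poly F)
  twisted_mulA twisted_mul1l twisted_mul1r twisted_mulDl twisted_mulDr
  (oner_neq0 {poly {poly F}}).

Definition twisted_scale (k : F) (f : twisted_poly F) : twisted_poly F :=
  (k%:P : {poly F}) *: (f : {poly {poly F}}).

Lemma twisted_scaleA k l (f : twisted_poly F) :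
  twisted_scale k (twisted_scale l f) = twisted_scale (k * l) f.
Proof. by rewrite /twisted_scale scalerA polyCM. Qed.

Lemma twisted_scale1 : left_id 1 twisted_scale.
Proof. by move=> f; rewrite /twisted_scale scale1r. Qed.

Lemma twisted_scaleDr : right_distributive twisted_scale +%R.
Proof. by move=> k f g; rewrite /twisted_scale scalerDr. Qed.

Lemma twisted_scaleDl (f : twisted_poly F) :
  {morph twisted_scale^~ f : k l / k + l}.
Proof. by move=> k l; rewrite /twisted_scale polyCD scalerDl. Qed.

HB.instance Definition _ := GRing.Zmodule_isLmodule.Build F (twisted_poly F)
  twisted_scaleA twisted_scale1 twisted_scaleDr twisted_scaleDl.

Lemma twisted_scaleAl (k : F) (f g : twisted_poly F) : k *: (f * g) = k *: f * g.
Proof.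
change (k%:P *: twisted_mul f g = twisted_mul (k%:P *: (f : {poly {poly F}})) g).
elim/twisted_ind: f => [|f f' IH IH'|a i].
- by rewrite scaler0 !twisted_mul0l scaler0.
- by rewrite !(twisted_mulDl, scalerDr) IH IH'.
elim/twisted_ind: g => [|g g' IH IH'|b j].
- by rewrite !twisted_mul0r scaler0.
- by rewrite !(twisted_mulDr, scalerDr) IH IH'.
by rewrite scalerA !twisted_mul_monom scalerA mulrA.
Qed.

HB.instance Definition _ :=
  GRing.Lmodule_isLalgebra.Build F (twisted_poly F) twisted_scaleAl.

Lemma twisted_scaleAr (k : F) (f g : twisted_poly F) : k *: (f * g) = f * (k *: g).
Proof.
change (k%:P *: twisted_mul f g = twisted_mul f (k%:P *: (g : {poly {poly F}}))).
have kq i : (k%:P : {poly F}) ^+ (q ^ i)%N = k%:P.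
  by elim: i => [|i IHi]; rewrite ?expr1 // expnSr exprM IHi -polyC_exp expf_card.
elim/twisted_ind: f => [|f f' IH IH'|a i].
- by rewrite !twisted_mul0l scaler0.
- by rewrite !(twisted_mulDl, scalerDr) IH IH'.
elim/twisted_ind: g => [|g g' IH IH'|b j].
- by rewrite scaler0 !twisted_mul0r scaler0.
- by rewrite !(twisted_mulDr, scalerDr) IH IH'.
by rewrite scalerA !twisted_mul_monom scalerA exprMn kq mulrCA.
Qed.

HB.instance Definition _ :=
  GRing.Lalgebra_isAlgebra.Build F (twisted_poly F) twisted_scaleAr.

End TwistedPolyRing.

Section Carlitz.

Variable F : finFieldType.

Definition tau : twisted_poly F := ('X : {poly {poly F}}).

(* The constant 'X%:P is T, seen in A{tau}. *)
Definition carlitz : {poly F} -> twisted_poly F :=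
  horner_alg ((('X%:P : {poly {poly F}}) : twisted_poly F) + tau).

Lemma tau_mul (a : {poly F}) :
  tau * (a%:P : twisted_poly F) = ((a ^+ #|F|)%:P : twisted_poly F) * tau.
Proof.
change (twisted_mul 'X a%:P = twisted_mul (a ^+ #|F|)%:P 'X).
have XE : 'X = (1 : {poly F}) *: 'X^1 by rewrite scale1r expr1.
have CE (b : {poly F}) : b%:P = b *: 'X^0 by rewrite expr0 alg_polyC.
by rewrite [in LHS]XE [in RHS]XE 2!CE !twisted_mul_monom mul1r expr1n mulr1 expn1.
Qed.

Lemma carlitzT : carlitz 'X = (('X%:P : {poly {poly F}}) : twisted_poly F) + tau.
Proof. exact: horner_algX. Qed.

Definition linear_poly (f : twisted_poly F) : {poly {poly F}} :=
  \sum_(i < size (f : {poly {poly F}}))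
     (f : {poly {poly F}})`_i *: 'X^(#|F| ^ i).

Definition c_Wieferich (P : {poly F}) : Prop :=
  [/\ P \is monic, irreducible_poly P &
      P ^+ 2 %| (linear_poly (carlitz P)).[1] - 1].

Definition bracket (n : nat) : {poly F} := 'X^(#|F| ^ n) - 'X.

Definition M (d : nat) : {poly F} :=
  \sum_(k < d) (-1) ^+ k * \prod_(1 <= j < k.+1) bracket (d - j).

Definition P19 (c : F) : {poly F} :=
  'X^5 + (11 + 17 * c +  9 * c ^+ 2) *: 'X^4
       + ( 3 +  7 * c + 18 * c ^+ 2) *: 'X^3
       + ( 2 +  5 * c +  6 * c ^+ 2) *: 'X^2
       + ( 3 +  3 * c + 11 * c ^+ 2) *: 'X
       + ( 6 + 17 * c +  5 * c ^+ 2)%:P.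

End Carlitz.

(* Main.v *)
Require Import Defs.
From HB Require Import structures.
From mathcomp Require Import all_boot all_order all_algebra all_field.
From mathcomp Require Import ring.
From Stdlib Require NArith.

Set Implicit Arguments.
Unset Strict Implicit.
Unset Printing Implicit Defensive.

Import GRing.Theory.

Local Open Scope ring_scope.

(** Everything is decided in the residue ring R = A / P, where P = P19 c, by a
    handful of congruences modulo P, and no computation modulo P^2 is made.

    Irreducibility. An irreducible D divides [n] exactly when deg D divides n
    ([irreducible_dvd_bracket]). As 5 is prime, P is irreducible once P | [5]
    and P is coprime to [1]: an irreducible factor has degree 1 or 5, and degree
    1 is excluded ([rabin_irreducible]).

    The Wieferich property. Write rho_P = \sum_i a_i tau^i. Then a_0 = P, the
    a_i vanish above d = deg P, and a_d = 1. Since rho_P commutes with rho_T,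
    [i+1] a_(i+1) = a_i^q - a_i. For 0 < i < d the bracket [i] is prime to P, so P
    divides a_i, hence a_i^q = 0 mod P^2 and the recursion becomes linear:
    [1]...[i] a_i = (-1)^i P mod P^2. Summing over i < d gives
        [1]...[d-1] (rho_P(1) - 1) = (-1)^(d-1) P M_d  mod P^2,
    so that P is c-Wieferich if and only if P | M_d ([wieferich_criterion]).
    This also yields the common factor of [5] and M_5, since P | [5].

    It remains to know T^(q^5) = T, M_5 = 0 and the invertibility of T^q - T in
    R. The ring R is obtained from Z/19 by adjoining in turn a root of two monic
    polynomials, and its elements are coded by lists of lists of integers
    ([extension_code]); the sequences T^(q^n) and M_n are computed together by
    [frobenius_run], thanks to M_(n+1) = 1 - [n] M_n.

    Finally, in P(T+gamma) - P(T) the coefficient of T^4 is 5 gamma, which is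
    not zero in characteristic 19 ([translate_neq]). *)

(** * Irreducible divisors of the brackets *)

Section Brackets.

Variable F : finFieldType.
Implicit Types (f g D P : {poly F}).

Let q := #|F|.

Lemma cardF_expn_gt0 i : (0 < q ^ i)%N.
Proof. by rewrite expn_gt0 (ltnW (card_finNzRing_gt1 F)). Qed.

Lemma polyC_exp_cardF (a : F) i : a%:P ^+ (q ^ i)%N = a%:P :> {poly F}.
Proof.
by elim: i => [|i IHi]; rewrite ?expr1 // expnSr exprM IHi -polyC_exp expf_card.
Qed.

Lemma bracketD i j : bracket F (i + j) = bracket F i ^+ (q ^ j)%N + bracket F j.
Proof.
have E : 'X^(q ^ (i + j)) = bracket F i ^+ (q ^ j)%N + 'X^(q ^ j) :> {poly F}.
  by rewrite -twisted_exprD subrK expnD exprM.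
by rewrite {1}/bracket E addrA.
Qed.

Lemma bracket_dvd_mul d k : bracket F d %| bracket F (k * d).
Proof.
elim: k => [|k IHk]; first by rewrite /bracket expn0 expr1 subrr dvdp0.
by rewrite mulSn addnC bracketD dvdp_add // dvdp_exp ?cardF_expn_gt0.
Qed.

(** Modulo [i] the power map of exponent q^i fixes T and the constants, and it
    is a ring morphism, so it fixes all of A. *)
Lemma bracket_dvd_expB i f : bracket F i %| f ^+ (q ^ i)%N - f.
Proof.
elim/poly_ind: f => [|f a IHf].
  by rewrite expr0n gtn_eqF ?cardF_expn_gt0 // subr0 dvdp0.
rewrite twisted_exprD exprMn polyC_exp_cardF opprD addrACA subrr addr0.
have -> : f ^+ (q ^ i) * 'X ^+ (q ^ i) - f * 'X =
    (f ^+ (q ^ i)%N - f) * 'X ^+ (q ^ i) + f * bracket F i.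
  by rewrite /bracket mulrBl mulrBr addrA subrK.
by apply: dvdp_add; [apply: dvdp_mulr | apply: dvdp_mull].
Qed.

Lemma in_qpoly_eq0 (R : idomainType) (h p : {poly R}) :
  h \is monic -> (1 < size h)%N -> (in_qpoly h p == 0) = (h %| p).
Proof.
move=> hM h1; have mkE : mk_monic h = h by rewrite /mk_monic h1 hM.
by rewrite -val_eqE /= mkE -Pdiv.IdomainMonic.modpE.
Qed.

(** The field K = A / D has q^d elements, which gives D | [d]; as the brackets
    are additive up to Frobenius powers, only the remainder of n modulo d
    counts. If D | [i] with 0 < i < d, all q^d elements of K are roots of
    X^(q^i) - X, which has at most q^i of them. *)
Lemma irreducible_dvd_bracket_monic D n : irreducible_poly D -> D \is monic ->
  (D %| bracket F n) = ((size D).-1 %| n)%N.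
Proof.
move=> irrD monD; have D1 := irrD.1.
pose d := (size D).-1; have d_gt0 : (0 < d)%N by rewrite -ltnS prednK // ltnW.
have hI : monic_irreducible_poly D by [].
pose K : finFieldType := {poly %/ D with hI}.
have cardK : #|K| = (q ^ d)%N by rewrite card_qfpoly.
have Dd : D %| bracket F d.
  rewrite -in_qpoly_eq0 // rmorphB rmorphXn /= -cardK.
  by rewrite (@expf_card K) subrr.
have Di i : (0 < i < d)%N -> ~~ (D %| bracket F i).
  case/andP=> i0 id; apply/negP => DiF.
  have q1 : (1 < q ^ i)%N by rewrite -{1}(expn0 q) ltn_exp2l ?card_finNzRing_gt1.
  have fix_i (y : K) : y ^+ (q ^ i) = y.
    have yE : y = in_qpoly D (val (y : {poly %/ D})).
      by apply/esym/val_inj/in_qpoly_small/size_mk_monic.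
    apply/eqP; rewrite -subr_eq0 yE.
    rewrite -[X in X - _](rmorphXn (in_qpoly D)) -[X in X == _](rmorphB (in_qpoly D)).
    by rewrite in_qpoly_eq0 // (dvdp_trans DiF) ?bracket_dvd_expB.
  have szQ : size ('X^(q ^ i) - 'X : {poly K}) = (q ^ i).+1.
    by rewrite size_polyDl ?size_polyXn // size_polyN size_polyX ltnS.
  have Q0 : 'X^(q ^ i) - 'X != 0 :> {poly K} by rewrite -size_poly_eq0 szQ.
  have := max_poly_roots Q0 _ (enum_uniq K).
  rewrite -cardE cardK szQ ltnS leq_exp2l ?card_finNzRing_gt1 // leqNgt id.
  suff: all (root ('X^(q ^ i) - 'X)) (enum K) by move=> -> /(_ isT).
  by apply/allP => y _; rewrite rootE !hornerE ?hornerXn fix_i subrr.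
rewrite {1}(divn_eq n d) bracketD dvdp_addr; last first.
  apply: dvdp_trans Dd (dvdp_trans (bracket_dvd_mul d (n %/ d)) _).
  by rewrite dvdp_exp ?cardF_expn_gt0.
rewrite /dvdn -/d; case: (posnP (n %% d)) => [->|n0].
  by rewrite /bracket expn0 expr1 subrr dvdp0.
by rewrite (negbTE (Di _ _)) ?n0 ?ltn_pmod // -lt0n n0.
Qed.

(** Divisibility and degree do not see the leading coefficient, whereas the
    field A / D used in the monic case is built from a monic D. *)
Lemma irreducible_dvd_bracket D n : irreducible_poly D ->
  (D %| bracket F n) = ((size D).-1 %| n)%N.
Proof.
move=> irrD; have lD : lead_coef D != 0 by rewrite lead_coef_eq0 irredp_neq0.
pose E := (lead_coef D)^-1 *: D.
have ED : E %= D by rewrite eqp_scale ?invr_eq0.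
rewrite -(eqp_dvdl _ ED) -(eqp_size ED) irreducible_dvd_bracket_monic //.
  split=> [|g g1 gE]; first by rewrite (eqp_size ED); exact: irrD.1.
  by rewrite (eqp_trans (irrD.2 g g1 _)) 1?eqp_sym // -(eqp_dvdr _ ED).
by rewrite monicE lead_coefZ mulVf.
Qed.

Lemma irreducible_divisor f : (1 < size f)%N ->
  exists2 D, irreducible_poly D & D %| f.
Proof.
have [n] := ubnP (size f); elim: n f => // n IHn f; rewrite ltnS => fn f1.
have [irrf|] := boolP (irreducibleb f); first by exists f => //; apply/irreducibleP.
rewrite /irreducibleb f1 negb_forall => /existsP[g].
rewrite negb_imply -ltnNge -Pdiv.Idomain.dvdpE => /andP[gf g1].
have [|D irrD Dg] := IHn g _ g1; last by exists D => //; exact: dvdp_trans gf.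
apply: leq_trans fn; apply: leq_ltn_trans (size_npoly g) _.
by rewrite ltn_predL ltnW.
Qed.

(** Rabin's irreducibility test, in prime degree: the degree of an irreducible
    factor divides n, and coprimality to [1] excludes degree 1. *)
Lemma rabin_irreducible n P : prime n -> size P = n.+1 ->
  P %| bracket F n -> coprimep P (bracket F 1) -> irreducible_poly P.
Proof.
move=> pr_n szP Pn P1; split=> [|D D1 DP]; first by rewrite szP ltnS prime_gt0.
have P0 : P != 0 by rewrite -size_poly_eq0 szP.
have D0 : D != 0 by apply: contraNneq P0 => D0; move: DP; rewrite D0 dvd0p.
have [|E irrE ED] := @irreducible_divisor D.
  by rewrite ltn_neqAle eq_sym D1 size_poly_gt0.
have EP := dvdp_trans ED DP.
have : ((size E).-1 %| n)%N.
  by rewrite -irreducible_dvd_bracket // (dvdp_trans EP).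
have E1 := irrE.1; have szE := ltn_predK E1.
case/primeP: (pr_n) => _ /[apply] /orP[] /eqP dE.
  have EP1 : E %| bracket F 1 by rewrite irreducible_dvd_bracket // dE.
  have /coprimepP/(_ E EP EP1) := P1.
  by rewrite -size_poly_eq1 => /eqP szE1; rewrite szE1 in E1.
rewrite -dvdp_size_eqp // eqn_leq dvdp_leq //= szP -dE szE dvdp_leq //.
Qed.

End Brackets.

(** * The Carlitz module and the Wieferich criterion *)

Section CarlitzCoefficients.

Variable F : finFieldType.
Implicit Types (a P : {poly F}) (f : {poly {poly F}}).

Let q := #|F|.

Lemma twisted_mulTl f i :
  (twisted_mul ('X%:P + 'X) f : {poly {poly F}})`_i =
  'X * f`_i + (if i is j.+1 then f`_j ^+ q else 0).
Proof.
elim/twisted_ind: f i => [|f g IHf IHg|a k] i.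
- rewrite twisted_mul0r !coef0 mulr0 add0r; case: i => // i.
  by rewrite coef0 expr0n gtn_eqF // ltnW // card_finNzRing_gt1.
- rewrite twisted_mulDr !coefD IHf IHg mulrDr addrACA; congr (_ + _).
  case: i => [|i]; rewrite ?addr0 // coefD.
  by have:= twisted_exprD 1 f`_i g`_i; rewrite expn1.
have -> : 'X%:P + 'X = 'X *: 'X^0 + 1 *: 'X^1 :> {poly {poly F}}.
  by rewrite alg_polyC scale1r.
rewrite twisted_mulDl !twisted_mul_monom coefD !coefZ !coefXn.
rewrite expn0 expn1 expr1 mul1r mulrA; congr (_ + _).
case: i => [|i]; rewrite ?mulr0 // coefZ coefXn eqSS.
case: (i == k); rewrite ?mulr1 // !mulr0 expr0n gtn_eqF //.
by rewrite ltnW // card_finNzRing_gt1.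
Qed.

Lemma twisted_mulTr f i :
  (twisted_mul f ('X%:P + 'X) : {poly {poly F}})`_i =
  f`_i * 'X^(q ^ i) + (if i is j.+1 then f`_j else 0).
Proof.
elim/twisted_ind: f i => [|f g IHf IHg|a k] i.
- by rewrite twisted_mul0l !coef0 mul0r add0r; case: i => // i; rewrite coef0.
- rewrite twisted_mulDl !coefD IHf IHg mulrDl addrACA; congr (_ + _).
  by case: i => [|i]; rewrite ?addr0 // coefD.
have -> : 'X%:P + 'X = 'X *: 'X^0 + 1 *: 'X^1 :> {poly {poly F}}.
  by rewrite alg_polyC scale1r.
rewrite twisted_mulDr !twisted_mul_monom coefD !coefZ !coefXn addn0 addn1.
rewrite expr1n mulr1; congr (_ + _).
  by case: eqP => [->|_]; rewrite ?mulr1 // !mulr0 mul0r.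
by case: i => [|i]; rewrite ?mulr0 // coefZ coefXn eqSS.
Qed.

Definition carlitz_coef a i : {poly F} := (carlitz a : {poly {poly F}})`_i.

Lemma carlitz_coefD a b i :
  carlitz_coef (a + b) i = carlitz_coef a i + carlitz_coef b i.
Proof. by rewrite /carlitz_coef /carlitz rmorphD coefD. Qed.

Lemma carlitz_coefC (k : F) i : carlitz_coef k%:P i = k%:P *+ (i == 0)%N.
Proof.
rewrite /carlitz_coef /carlitz horner_algC.
change ((k%:P *: (1 : {poly {poly F}}))`_i = k%:P *+ (i == 0)%N).
by rewrite coefZ coef1 mulr_natr.
Qed.

Lemma carlitz_coef_mulXl a i : carlitz_coef ('X * a) i =
  'X * carlitz_coef a i + (if i is j.+1 then carlitz_coef a j ^+ q else 0).
Proof.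
rewrite /carlitz_coef.
have -> : carlitz ('X * a) = carlitz 'X * carlitz a by rewrite /carlitz rmorphM.
rewrite carlitzT; exact: twisted_mulTl.
Qed.

Lemma carlitz_coef_mulXr a i : carlitz_coef (a * 'X) i =
  carlitz_coef a i * 'X^(q ^ i) + (if i is j.+1 then carlitz_coef a j else 0).
Proof.
rewrite /carlitz_coef.
have -> : carlitz (a * 'X) = carlitz a * carlitz 'X by rewrite /carlitz rmorphM.
rewrite carlitzT; exact: twisted_mulTr.
Qed.

(** Comparison of the coefficients of rho_T rho_a and rho_a rho_T. *)
Lemma carlitz_coef_rec a i :
  bracket F i.+1 * carlitz_coef a i.+1 = carlitz_coef a i ^+ q - carlitz_coef a i.
Proof.
have := carlitz_coef_mulXl a i.+1.
rewrite mulrC carlitz_coef_mulXr => E; rewrite /bracket mulrBl.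
by apply/eqP; rewrite subr_eq addrAC eq_sym subr_eq addrC -E mulrC.
Qed.

Lemma carlitz_coef0 a : carlitz_coef a 0 = a.
Proof.
elim/poly_ind: a => [|a k IHa].
  by rewrite -polyC0 carlitz_coefC.
by rewrite carlitz_coefD carlitz_coefC carlitz_coef_mulXr IHa addr0 expn0 expr1.
Qed.

Lemma carlitz_coef_ge a i : (size a <= i)%N -> carlitz_coef a i = 0.
Proof.
elim/poly_ind: a i => [|a k IHa] i.
  by rewrite -polyC0 carlitz_coefC mul0rn.
rewrite size_MXaddC; case: ifP => [/andP[/eqP-> /eqP->]|_] ai.
  by rewrite mul0r addr0 -polyC0 carlitz_coefC mul0rn.
case: i ai => // i ai; rewrite carlitz_coefD carlitz_coefC carlitz_coef_mulXr.
by rewrite !IHa // ?mul0r ?addr0 // ltnW.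
Qed.

Lemma carlitz_coef_lead a : carlitz_coef a (size a).-1 = (lead_coef a)%:P.
Proof.
elim/poly_ind: a => [|a k IHa].
  by rewrite lead_coef0 -polyC0 carlitz_coefC mul0rn.
have [->|a0] := eqVneq a 0.
  rewrite mul0r add0r carlitz_coefC lead_coefC.
  by case: (eqVneq k 0) => [->|k0]; rewrite ?mul0rn // size_polyC k0.
rewrite lead_coefDl ?lead_coefMX; last first.
  by rewrite size_mulX // size_polyC (leq_ltn_trans (leq_b1 _)) // ltnS size_poly_gt0.
rewrite size_MXaddC (negbTE a0) /= -[size a]prednK ?size_poly_gt0 //.
by rewrite carlitz_coefD carlitz_coefC carlitz_coef_mulXr IHa carlitz_coef_ge
  ?mul0r ?add0r ?addr0 // prednK ?size_poly_gt0.
Qed.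

(** All powers of 1 being equal, evaluation at 1 does not see the difference
    between tau^i and X^(q^i). *)
Lemma linear_poly_at1 (f : twisted_poly F) :
  (linear_poly f).[1] = (f : {poly {poly F}}).[1].
Proof.
rewrite /linear_poly horner_sum [RHS]horner_coef; apply: eq_bigr => i _.
by rewrite hornerZ hornerXn !expr1n.
Qed.

Lemma M_rec n : M F n.+1 = 1 - bracket F n * M F n.
Proof.
rewrite /M big_ord_recl /= expr0 big_geq // mulr1; congr (_ + _).
rewrite mulr_sumr -sumrN; apply: eq_bigr => k _ /=.
rewrite /bump leq0n add1n [in LHS]big_add1 [in LHS]big_nat_recl // subn1 /=.
by rewrite exprS mulN1r mulNr mulrCA [in RHS]big_add1.
Qed.

Lemma carlitz_at1 P : P \is monic -> (linear_poly (carlitz P)).[1] - 1 =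
  \sum_(i < (size P).-1) carlitz_coef P i.
Proof.
move=> monP; have szP : (0 < size P)%N by rewrite size_poly_gt0 monic_neq0.
rewrite linear_poly_at1 (@horner_coef_wide _ (size P).-1.+1); last first.
  by apply/leq_sizeP => i Pi; apply: carlitz_coef_ge; rewrite -(prednK szP).
rewrite big_ord_recr /= -/(carlitz_coef P _) carlitz_coef_lead (monicP monP).
by rewrite expr1n mulr1 addrK; apply: eq_bigr => i _; rewrite expr1n mulr1.
Qed.

(** Below the degree of P, a_i is divisible by P because [i] is prime to P, so
    a_i^q vanishes modulo P^2 and the recursion of [carlitz_coef_rec] becomes
    [i+1] a_(i+1) = - a_i. The partial sums then follow the recursion of M. *)
Lemma wieferich_congruence P n : irreducible_poly P -> (n.+1 < size P)%N ->
  let B := \prod_(1 <= j < n.+1) bracket F j in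
  P ^+ 2 %| B * (\sum_(i < n.+1) carlitz_coef P i) - (-1) ^+ n * (P * M F n.+1).
Proof.
move=> irrP nP.
(* The induction carries the single coefficient along with the partial sum. *)
suff [_ _] : [/\ P %| carlitz_coef P n,
   P ^+ 2 %| (\prod_(1 <= j < n.+1) bracket F j) * carlitz_coef P n - (-1) ^+ n * P &
   P ^+ 2 %| (\prod_(1 <= j < n.+1) bracket F j) * (\sum_(i < n.+1) carlitz_coef P i)
             - (-1) ^+ n * (P * M F n.+1)] by [].
elim: n nP => [|n IHn] nP.
  rewrite big_geq // big_ord1 carlitz_coef0 M_rec /M big_ord0 mulr0 subr0.
  by rewrite mulr1 !mul1r subrr dvdp0.
have [Pa IHa IHS] := IHn (ltnW nP).
have rec := carlitz_coef_rec P n.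
have Paq : P ^+ 2 %| carlitz_coef P n ^+ q.
  apply: dvdp_trans (dvdp_exp2r 2 Pa) _.
  by rewrite dvdp_exp2l // card_finNzRing_gt1.
rewrite big_nat_recr //=; set B := \prod_(1 <= j < n.+1) _ in IHa IHS *.
set b := bracket F n.+1 in rec *; set a := carlitz_coef P n in rec Pa IHa Paq *.
rewrite big_ord_recr /= M_rec -/b.
set S := \sum_(i < n.+1) _ in IHS *; set a' := carlitz_coef P n.+1 in rec *.
have a'E : P ^+ 2 %| B * b * a' - (-1) ^+ n.+1 * P.
  rewrite -mulrA rec.
  have -> : B * (a ^+ q - a) - (-1) ^+ n.+1 * P =
     B * a ^+ q - (B * a - (-1) ^+ n * P) by rewrite exprS; ring.
  by rewrite dvdp_sub // dvdp_mull.
split=> //.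
  have cop : coprimep P b.
    rewrite irreducible_poly_coprime // irreducible_dvd_bracket //.
    by rewrite gtnNdvd // -ltnS (ltn_predK nP).
  rewrite -(Gauss_dvdpr _ cop) rec dvdp_sub // (dvdp_trans _ Paq) //.
  by rewrite dvdp_mulr.
have -> : B * b * (S + a') - (-1) ^+ n.+1 * (P * (1 - b * M F n.+1)) =
  b * (B * S - (-1) ^+ n * (P * M F n.+1)) + (B * b * a' - (-1) ^+ n.+1 * P) by rewrite exprS; ring.
by rewrite dvdp_add // dvdp_mull.
Qed.

(** The product of the brackets [j] with 0 < j < deg P is prime to P, so
    [wieferich_congruence] can be divided by it, and then by P. *)
Lemma wieferich_criterion P : irreducible_poly P -> P \is monic ->
  (P ^+ 2 %| (linear_poly (carlitz P)).[1] - 1) = (P %| M F (size P).-1).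
Proof.
move=> irrP monP; rewrite carlitz_at1 //.
have [n szP] : exists n, size P = n.+2.
  by case: (size P) irrP.1 => [|[|n]] // _; exists n.
have := @wieferich_congruence P n irrP; rewrite szP /= => /(_ (ltnSn _)).
set B := \prod_(1 <= j < n.+1) _; set S := \sum_(i < n.+1) _ => PBS.
have cop : coprimep (P ^+ 2) B.
  rewrite coprimep_expl // /B big_nat; apply: (big_ind (coprimep P)) => [|x y|i /andP[i0 ilt]].
  - exact: coprimep1.
  - by rewrite coprimepMr => -> ->.
  rewrite irreducible_poly_coprime // irreducible_dvd_bracket // szP.
  by rewrite gtnNdvd.
rewrite -(Gauss_dvdpr _ cop).
rewrite -[B * S](subrK ((-1) ^+ n * (P * M F n.+1))) dvdp_addr //.
rewrite -signr_odd expr2; case: (odd n); rewrite ?expr1 ?mulN1r ?dvdpNr ?mul1r.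
  by rewrite dvdp_mul2l // irredp_neq0.
by rewrite dvdp_mul2l // irredp_neq0.
Qed.

End CarlitzCoefficients.

(** * Translations *)

Lemma coef_translate (R : idomainType) (p : {poly R}) (a : R) n :
  (size p <= n.+2)%N ->
  (p \Po ('X + a%:P))`_n = p`_n + p`_n.+1 * a *+ n.+1.
Proof.
elim/poly_ind: p n => [|p k IHp] n.
  by rewrite comp_poly0 !coef0 mul0r mul0rn addr0.
rewrite size_MXaddC; case: ifP => [/andP[/eqP-> /eqP->] _|_ pn].
  by rewrite mul0r addr0 comp_poly0 !coef0 mul0r mul0rn addr0.
rewrite comp_polyD comp_polyM comp_polyX comp_polyC mulrDr !coefD !coefMX !coefC.
rewrite coefMC /= addr0; case: n pn => [|n] pn /=.
  have [b ->] : exists b, p = b%:P by exists p`_0; apply: size1_polyC.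
  by rewrite comp_polyC coefC !add0r addrC.
have -> : (p \Po ('X + a%:P))`_n.+1 = p`_n.+1.
  by rewrite IHp ?(ltnW pn) // [p`_n.+2]nth_default // mul0r mul0rn addr0.
by rewrite IHp // !addr0 -addrA -mulrSr.
Qed.

(** The coefficient of X^n changes by (n+1) a times the leading coefficient. *)
Lemma translate_neq (R : idomainType) (p : {poly R}) n (a : R) :
  size p = n.+2 -> n.+1%:R != 0 :> R -> a != 0 -> p \Po ('X + a%:P) != p.
Proof.
move=> szp n0 a0; apply/eqP => /(congr1 (fun f : {poly R} => f`_n))/eqP.
rewrite coef_translate ?szp // -subr_eq0 addrAC subrr add0r -mulr_natr !mulf_eq0.
rewrite (negbTE n0) (negbTE a0) !orbF -[n.+1]/(n.+2.-1) -szp -lead_coefE.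
by rewrite lead_coef_eq0 -size_poly_eq0 szp.
Qed.

(** * Computation with coded residues *)

(** The operations of a computable model of a ring. They satisfy no axioms, since
    an element may have several codes; what they mean is said by [decodes], which
    only asks the zero test to be sound. *)
Record ring_code := RingCode {
  code :> Type;
  code0 : code;
  code_add : code -> code -> code;
  code_opp : code -> code;
  code_mul : code -> code -> code;
  code_is0 : code -> bool }.

Record decodes (C : ring_code) (R : comNzRingType) (v : C -> R) : Prop := Decodes {
  decode0 : v (code0 C) = 0;
  decode_add a b : v (code_add a b) = v a + v b;
  decode_opp a : v (code_opp a) = - v a;
  decode_mul a b : v (code_mul a b) = v a * v b;
  decode_is0 a : code_is0 a -> v a = 0 }.

Definition code_sub (C : ring_code) (a b : C) := code_add a (code_opp b).

Lemma decode_sub (C : ring_code) (R : comNzRingType) (v : C -> R) (a b : C) :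
  decodes v -> v (code_sub a b) = v a - v b.
Proof. by move=> vP; rewrite /code_sub decode_add // decode_opp. Qed.

(** Adjoining to a coded ring an element x with x^n + rel_(n-1) x^(n-1) + ... +
    rel_0 = 0. A list codes its value as a polynomial in x, lowest degree first,
    and lists shorter than n are allowed. *)
Section Extension.

Variables (C : ring_code) (rel : seq C).

Fixpoint ext_add (s u : seq C) : seq C :=
  match s, u with
  | a :: s', b :: u' => code_add a b :: ext_add s' u'
  | [::], _ => u
  | _, [::] => s
  end.

Definition ext_scale (a : C) (s : seq C) : seq C := [seq code_mul a b | b <- s].

(** Multiplication by x. The relation is applied when it brings a list of length
    n back to length n; longer lists do not arise in products of lists of length
    at most n, and leaving them unreduced keeps the value right without a length
    invariant. *)
Definition ext_shift (s : seq C) : seq C :=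
  if drop (size rel).-1 s is [:: a] then
    ext_add (code0 C :: take (size rel).-1 s) (ext_scale (code_opp a) rel)
  else code0 C :: s.

Definition ext_mul (s u : seq C) : seq C :=
  foldr (fun a w => ext_add (ext_scale a u) (ext_shift w)) [::] s.

Definition extension_code : ring_code :=
  RingCode [::] ext_add (map (@code_opp C)) ext_mul (all (@code_is0 C)).

Variables (R : comNzRingType) (v : C -> R) (x : R).

Definition ext_val (s : seq C) : R := foldr (fun a y => v a + x * y) 0 s.

Hypothesis vP : decodes v.
Hypotheses (rel_gt0 : (0 < size rel)%N) (relP : x ^+ size rel + ext_val rel = 0).

Lemma ext_decodes : @decodes extension_code R ext_val.
Proof.
have addP s u : ext_val (ext_add s u) = ext_val s + ext_val u.
  elim: s u => [|a s IHs] [|b u] /=; rewrite ?add0r ?addr0 //.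
  by rewrite decode_add // IHs mulrDr addrACA.
have scaleP a s : ext_val (ext_scale a s) = v a * ext_val s.
  elim: s => [|b s IHs] /=; rewrite ?mulr0 //.
  by rewrite decode_mul // IHs mulrDr mulrCA.
have catP s u : ext_val (s ++ u) = ext_val s + x ^+ size s * ext_val u.
  elim: s => [|a s IHs] /=; first by rewrite mul1r add0r.
  by rewrite IHs mulrDr mulrA -exprS addrA.
have shiftP s : ext_val (ext_shift s) = x * ext_val s.
  rewrite /ext_shift; case E: (drop _ s) => [|a [|]];
    rewrite ?addP /= ?decode0 ?add0r //.
  rewrite scaleP decode_opp //.
  rewrite -[in RHS](cat_take_drop (size rel).-1 s) E catP mulrDr /= mulr0 addr0.
  rewrite size_takel; last first.
    by rewrite ltnW // -subn_gt0 -size_drop E.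
  rewrite mulrA -exprS prednK //.
  by congr (_ + _); rewrite mulNr [RHS]mulrC -mulrN; congr (_ * _);
    apply/eqP; rewrite eq_sym -addr_eq0 relP.
split=> //=.
- by elim=> [|a s IHs] /=; rewrite ?oppr0 // decode_opp // IHs mulrN opprD.
- elim=> [|a s IHs] u /=; first by rewrite mul0r.
  by rewrite addP scaleP shiftP IHs mulrDl mulrA.
by elim=> [|a s IHs] //= /andP[/(decode_is0 vP)-> /IHs->]; rewrite mulr0 addr0.
Qed.

End Extension.

(** Negation is multiplication by m - 1, which avoids truncated subtraction. *)
Section Residues.

Variable m : BinNums.N.

Definition residue_code : ring_code :=
  RingCode BinNums.N0
    (fun a b => BinNat.N.modulo (BinNat.N.add a b) m)
    (fun a => BinNat.N.modulo (BinNat.N.mul (BinNat.N.pred m) a) m)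
    (fun a b => BinNat.N.modulo (BinNat.N.mul a b) m)
    (fun a => BinNat.N.eqb a BinNums.N0).

Variable R : comNzRingType.

Definition residue_val (a : BinNums.N) : R := (BinNat.N.to_nat a)%:R.

Lemma residue_decodes : BinNat.N.lt BinNums.N0 m -> residue_val m = 0 ->
  @decodes residue_code R residue_val.
Proof.
move=> m_gt0 mR.
have addP a b : residue_val (BinNat.N.add a b) = residue_val a + residue_val b.
  by rewrite /residue_val Nnat.N2Nat.inj_add natrD.
have mulP a b : residue_val (BinNat.N.mul a b) = residue_val a * residue_val b.
  by rewrite /residue_val Nnat.N2Nat.inj_mul natrM.
have modP a : residue_val (BinNat.N.modulo a m) = residue_val a.
  by rewrite [in RHS](BinNat.N.Div0.div_mod a m) addP mulP mR mul0r add0r.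
split=> //= [a b|a|a b|a]; rewrite ?modP ?addP ?mulP //.
  apply/eqP; rewrite -addr_eq0 -{2}[residue_val a]mul1r -mulrDl.
  rewrite -[1](_ : residue_val (BinNums.Npos BinNums.xH) = 1) // -addP.
  by rewrite BinNat.N.add_1_r BinNat.N.succ_pred_pos // mR mul0r.
by move/BinNat.N.eqb_eq->.
Qed.

End Residues.

Section Iteration.

Variables (C : ring_code) (one : C).

Definition code_exp19 (a : C) : C :=
  let sq b := code_mul b b in
  let a2 := sq a in code_mul (sq (sq (sq a2))) (code_mul a2 a).

(** The passage from (T^(q^n), M_n) to (T^(q^(n+1)), M_(n+1)) for q = 19^3: the
    first component gives the bracket [n] needed by [M_rec]. The iteration starts
    at M_0 = 0, the empty sum. *)
Definition frobenius_step (t : C) (s : C * C) : C * C :=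
  (iter 3 code_exp19 s.1,
   code_add one (code_opp (code_mul (code_add s.1 (code_opp t)) s.2))).

Definition frobenius_run (t : C) (n : nat) : C * C :=
  iter n (frobenius_step t) (t, code0 C).

End Iteration.

Lemma frobenius_runP (F : finFieldType) (C : ring_code) (R : comNzRingType)
    (v : C -> R) (phi : {rmorphism {poly F} -> R}) (one t : C) n :
  #|F| = (19 ^ 3)%N -> decodes v -> v one = 1 -> v t = phi 'X ->
  v (frobenius_run one t n).1 = phi 'X^(#|F| ^ n) /\
  v (frobenius_run one t n).2 = phi (M F n).
Proof.
move=> hF vP v1 vt.
have exp19P a : v (code_exp19 a) = v a ^+ 19.
  by rewrite /code_exp19 !decode_mul //; ring.
elim: n => [|n [IH1 IH2]].
  by rewrite /= decode0 // /M big_ord0 rmorph0.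
rewrite [frobenius_run _ _ _]/= -/(frobenius_run one t n); split.
  by rewrite /= !exp19P IH1 -!exprM -rmorphXn -exprM expnSr hF.
rewrite /= M_rec /bracket decode_add // decode_opp // decode_mul // decode_add //.
by rewrite decode_opp // IH1 IH2 v1 vt !(rmorphB, rmorphM, rmorph1).
Qed.

(** * The example over the field with 19^3 elements *)

(** The relation c^3 - 8 c^2 - 4 c - 11 = 0, whose coefficients -11, -4, -8 are
    here written as residues modulo 19. *)
Definition code_F : ring_code :=
  @extension_code (residue_code (BinNat.N.of_nat 19))
    (map BinNat.N.of_nat [:: 8; 15; 11]%N).

(** The relation P19(T) = 0, with the coefficients of P19 as they stand. *)
Definition code_P : ring_code :=
  @extension_code code_F (map (map BinNat.N.of_nat)
    [:: [:: 6; 17; 5]; [:: 3; 3; 11]; [:: 2; 5; 6]; [:: 3; 7; 18]; [:: 11; 17; 9]]%N).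

Definition code_T : code_P := map (map BinNat.N.of_nat) [:: [:: 0]; [:: 1]]%N.
Definition code_1 : code_P := map (map BinNat.N.of_nat) [:: [:: 1]]%N.

(** The inverse of T^q - T modulo P19, found as its power of exponent q^5 - 2. *)
Definition code_inv : code_P := map (map BinNat.N.of_nat)
  [:: [:: 9; 4; 1]; [:: 11; 18; 8]; [:: 2; 18; 13]; [:: 8; 14; 13]; [:: 15]]%N.

Lemma run_degree5 :
  code_is0 (code_sub (frobenius_run code_1 code_T 5).1 code_T) &&
  code_is0 (frobenius_run code_1 code_T 5).2.
Proof. by vm_compute. Qed.

Lemma run_inverse : code_is0 (code_sub
  (code_mul code_inv (code_sub (frobenius_run code_1 code_T 1).1 code_T)) code_1).
Proof. by vm_compute. Qed.

Section Example.

Variables (F : finFieldType) (c : F).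
Hypothesis hF : #|F| = (19 ^ 3)%N.
Hypothesis char19 : 19%:R = 0 :> F.
Hypothesis hc : c ^+ 3 = 8 * c ^+ 2 + 4 * c + 11.

(** Only the leading term matters for the degree and for monicity. *)
Lemma P19E : exists2 r : {poly F}, (size r <= 5)%N & P19 c = 'X^5 + r.
Proof.
rewrite /P19; set a := (X in X *: 'X^4); set b := (X in X *: 'X^3).
set d := (X in X *: 'X^2); set e := (X in X *: 'X); set g := (X in X%:P).
exists (a *: 'X^4 + b *: 'X^3 + d *: 'X^2 + e *: 'X + g%:P); last by rewrite !addrA.
have leD (f h : {poly F}) : (size f <= 5 -> size h <= 5 -> size (f + h)%R <= 5)%N.
  by move=> f5 h5; rewrite (leq_trans (size_polyD _ _)) // geq_max f5.
have leZ k n : (n < 5)%N -> (size (k *: 'X^n : {poly F})%R <= 5)%N.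
  by move=> n5; rewrite (leq_trans (size_scale_leq _ _)) ?size_polyXn.
do 4?apply: (leD); rewrite ?leZ ?(leq_trans (size_polyC_leq1 _)) //.
exact: (leZ _ 1%N).
Qed.

Lemma size_P19 : size (P19 c) = 6%N.
Proof. by have [r szr ->] := P19E; rewrite size_polyDl size_polyXn. Qed.

Lemma monic_P19 : P19 c \is monic.
Proof.
by have [r szr ->] := P19E; rewrite monicE lead_coefDl ?lead_coefXn ?size_polyXn.
Qed.

Let R : comNzRingType := {poly %/ P19 c}.
Let phi : {rmorphism {poly F} -> R} := in_qpoly (P19 c).

Lemma phi_eq0 f : (phi f == 0) = (P19 c %| f).
Proof. by rewrite in_qpoly_eq0 ?monic_P19 ?size_P19. Qed.

Lemma residue_val_nat n : residue_val R (BinNat.N.of_nat n) = phi (n%:R : F)%:P.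
Proof. by rewrite /residue_val Nnat.Nat2N.id !rmorph_nat. Qed.

Definition val_F : code_F -> R :=
  @ext_val (residue_code (BinNat.N.of_nat 19)) R (@residue_val R) (phi c%:P).

Definition val_P : code_P -> R := @ext_val code_F R val_F (phi 'X).

Definition at_c (s : seq nat) : F := foldr (fun n y => n%:R + c * y) 0 s.

Definition at_X (s : seq (seq nat)) : {poly F} :=
  foldr (fun r y => (at_c r)%:P + 'X * y) 0 s.

Lemma val_F_nat s : val_F (map BinNat.N.of_nat s) = phi (at_c s)%:P.
Proof.
elim: s => [|n s IHs]; first by rewrite /= polyC0 rmorph0.
rewrite /val_F /= residue_val_nat -/(val_F _) IHs.
by rewrite -rmorphM -rmorphD /= -polyCM -polyCD.
Qed.

Lemma val_P_nat s : val_P (map (map BinNat.N.of_nat) s) = phi (at_X s).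
Proof.
elim: s => [|r s IHs]; first by rewrite /= rmorph0.
by rewrite /val_P /= val_F_nat -/(val_P _) IHs -rmorphM -rmorphD.
Qed.

(** The two relations used by the code hold in A / P19: the one for c by
    hypothesis, up to a multiple of 19, and the one for T because it is P19. *)
Lemma val_P_decodes : decodes val_P.
Proof.
apply: ext_decodes => //.
  apply: ext_decodes => //.
    by apply: residue_decodes => //; rewrite residue_val_nat char19 polyC0 rmorph0.
  rewrite -/val_F val_F_nat size_map -!(rmorphXn, rmorphD) /=.
  rewrite hc (_ : _ + (8%:R + _) = 19%:R * (c ^+ 2 + c + 1)).
    by rewrite char19 mul0r polyC0 rmorph0.
  by rewrite /at_c /=; ring.
rewrite -/val_P val_P_nat size_map -rmorphXn -rmorphD [size _]/=.
apply/eqP; rewrite phi_eq0 (_ : 'X^5 + _ = P19 c) //.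
have at_cE i j k : at_c [:: i; j; k] = i%:R + j%:R * c + k%:R * c ^+ 2.
  by rewrite /at_c /=; ring.
rewrite /P19 /at_X -!mul_polyC -!at_cE; move: at_c {at_cE} => f /=; ring.
Qed.

Let val_P1 : val_P code_1 = 1.
Proof. by rewrite val_P_nat /at_X /at_c /= !mulr0 !addr0 rmorph1. Qed.

Let val_PT : val_P code_T = phi 'X.
Proof. by rewrite val_P_nat /at_X /at_c /= !mulr0 !addr0 add0r mulr1. Qed.

Let runP n := @frobenius_runP F code_P R val_P phi code_1 code_T n hF
  val_P_decodes val_P1 val_PT.

Lemma P19_dvd_bracket5 : P19 c %| bracket F 5.
Proof.
have vP := val_P_decodes.
(* Only the checked properties of the run matter from here on, not its value. *)
move: (frobenius_run code_1 code_T 5) run_degree5 (runP 5) => s run [E _].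
have /andP[/(decode_is0 vP) + _] := run.
by rewrite (decode_sub _ _ vP) E val_PT -rmorphB => /eqP; rewrite phi_eq0.
Qed.

Lemma P19_dvd_M5 : P19 c %| M F 5.
Proof.
move: (frobenius_run code_1 code_T 5) run_degree5 (runP 5) => s run [_ E].
have /andP[_ /(decode_is0 val_P_decodes)] := run.
by rewrite E => /eqP; rewrite phi_eq0.
Qed.

Lemma P19_coprime_bracket1 : coprimep (P19 c) (bracket F 1).
Proof.
have vP := val_P_decodes.
move: (frobenius_run code_1 code_T 1) run_inverse (runP 1) => s run [E _].
have [w vw] : exists w, val_P code_inv = phi w by rewrite val_P_nat; eexists.
move: code_inv vw run => inv vw /(decode_is0 vP).
move: code_1 code_T val_P1 val_PT => one t v1 vt.
rewrite (decode_sub _ _ vP) (decode_mul vP) (decode_sub _ _ vP) E vt v1 vw.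
rewrite -rmorphB -rmorphM -(rmorph1 phi) -rmorphB => /eqP.
rewrite phi_eq0 => /dvdpP[g wE]; apply/Bezout_eq1_coprimepP.
by exists (- g, w); rewrite /= mulNr -wE addrC subKr.
Qed.

Lemma P19_irreducible : irreducible_poly (P19 c).
Proof.
by apply: (@rabin_irreducible F 5);
  rewrite ?size_P19 ?P19_dvd_bracket5 ?P19_coprime_bracket1.
Qed.

End Example.

Theorem theorem1p1 (F : finFieldType) (hF : #|F| = (19 ^ 3)%N)
    (iota : {rmorphism 'F_19 -> F}) (c : F)
    (hgen : forall x : F, exists f : {poly 'F_19}, x = (map_poly iota f).[c])
    (hc : c ^+ 3 = 8 * c ^+ 2 + 4 * c + 11) :
  irreducible_poly (P19 c) /\
  size (P19 c) = 6%N /\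
  c_Wieferich (P19 c) /\
  ~~ coprimep (bracket F 5) (M F 5) /\
  ~~ (19 %| 5)%N /\
  (forall gamma : F, gamma != 0 -> P19 c \Po ('X + gamma%:P) != P19 c).
Proof.
have char19 : 19%:R = 0 :> F.
  by rewrite -(rmorph_nat iota) (_ : 19%:R = 0) ?rmorph0 //; apply: val_inj.
have irrP := P19_irreducible hF char19 hc.
have P5 := P19_dvd_bracket5 hF char19 hc.
have PM := P19_dvd_M5 hF char19 hc.
split=> //; split; first exact: size_P19.
split; first by split; rewrite ?monic_P19 // wieferich_criterion ?monic_P19 ?size_P19.
split.
  by apply/negP => /coprimepP/(_ _ P5 PM); rewrite -size_poly_eq1 size_P19.
split=> // gamma gamma0; apply: (@translate_neq _ _ 4) => //; first exact: size_P19.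
apply/eqP => five0; have /eqP := oner_neq0 F; case.
have -> : 1 = 4%:R * 5%:R - 19%:R :> F by ring.
by rewrite five0 char19 mulr0 subr0.
Qed.
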